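(* Let $\mathrm{BP}$ be a binary program in $n$ variables with constraints $Ax\leq b$, $x\in\{0,1\}^n$, where $A\in\mathbb{R}^{m\times n}$, $b\in\mathbb{R}^m$ and $\operatorname{Fes}(\mathrm{BP})\neq\emptyset$. Suppose that for each $\bar{x}\in\operatorname{Fes}(\mathrm{BP})$ there exists $\bar{y}\in\operatorname{Fes}(\mathrm{BP})$ such that $\bar{x}+\bar{y}\leq e$. Then $z_{i}\geq 0$ and $z_{i}\leq 1$ are facet defining inequalities of $P^{n}_{\overline{\mathrm{BPD}}}$, for all $i\in\{1,\ldots,n\}$.
   Context: $\operatorname{Fes}(\mathrm{BP})=\{x\in\{0,1\}^n: Ax\leq b\}$. $e$ is the all-ones vector, inequalities between vectors are entrywise, and $\oplus$ denotes concatenation of vectors. The diameter polytope is $P^{n}_{\overline{\mathrm{BPD}}}=\operatorname{conv}\{x\oplus y\oplus z\in\{0,1\}^{3n}: Ax\leq b,\ Ay\leq b,\ x+y-z\leq e\}\subseteq\mathbb{R}^{3n}$; points of $\mathbb{R}^{3n}$ are written $x\oplus y\oplus z$ with $x,y,z\in\mathbb{R}^n$. The dimension of a nonempty polytope is the dimension of its affine hull. If $a^Tw\leq a_0$ is a valid inequality for a polytope $P$, the face it defines is $\{w\in P: a^Tw=a_0\}$; a facet of $P$ is a face of dimension $\dim P-1$, and an inequality is facet defining if it is valid for $P$ and the face it defines is a facet. *)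

(* Defs.v *)
From HB Require Import structures.
From mathcomp Require Import all_boot all_order all_algebra.
From mathcomp Require Import boolp classical_sets reals.

Set Implicit Arguments.
Unset Strict Implicit.
Unset Printing Implicit Defensive.

Import Order.TTheory GRing.Theory Num.Theory.

Local Open Scope classical_set_scope.
Local Open Scope ring_scope.

Section Polyhedra.
Variables (R : realType) (N : nat).
Implicit Types (S P F : set 'cV[R]_N) (a : 'cV[R]_N) (beta : R) (d : nat).

Definition conv_hull S : set 'cV[R]_N :=
  [set w | exists (k : nat) (p : 'I_k -> 'cV[R]_N) (c : 'I_k -> R),
     [/\ forall j, S (p j), forall j, 0 <= c j, \sum_j c j = 1
       & w = \sum_j c j *: p j]].

Definition affine_hull S : set 'cV[R]_N :=
  [set w | exists (k : nat) (p : 'I_k -> 'cV[R]_N) (c : 'I_k -> R),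
     [/\ forall j, S (p j), \sum_j c j = 1 & w = \sum_j c j *: p j]].

(* The affine hull of S is a translate p + U of a linear subspace U with
   \dim U = d. No d satisfies this when S is empty. *)
Definition has_dim S d : Prop :=
  exists (p : 'cV[R]_N) (U : {vspace 'cV[R]_N}),
    affine_hull S = [set w | w - p \in U] /\ \dim U = d.

Definition dotv a (w : 'cV[R]_N) : R := (a^T *m w) 0 0.

Definition valid_ineq P a beta : Prop := forall w, P w -> dotv a w <= beta.

Definition face P a beta : set 'cV[R]_N := [set w | P w /\ dotv a w = beta].

Definition facet_defining P a beta : Prop :=
  valid_ineq P a beta /\ exists d, has_dim P d.+1 /\ has_dim (face P a beta) d.

End Polyhedra.

Section BinaryProgram.
Variable R : realType.

Definition le_vec N (u v : 'cV[R]_N) : Prop := forall j, u j 0 <= v j 0.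

Definition binary N (x : 'cV[R]_N) : Prop := forall j, x j 0 = 0 \/ x j 0 = 1.

Definition ones N : 'cV[R]_N := const_mx 1.

Definition Fes m n (A : 'M[R]_(m, n)) (b : 'cV[R]_m) : set 'cV[R]_n :=
  [set x | binary x /\ le_vec (A *m x) b].

Definition concat3 n (x y z : 'cV[R]_n) : 'cV[R]_(n + n + n) :=
  col_mx (col_mx x y) z.

Definition diameter_polytope m n (A : 'M[R]_(m, n)) (b : 'cV[R]_m) :
    set 'cV[R]_(n + n + n) :=
  conv_hull [set w | exists x y z : 'cV[R]_n,
    [/\ w = concat3 x y z, binary w, le_vec (A *m x) b, le_vec (A *m y) b
      & le_vec (x + y - z) (ones n)]].

Definition unitv n (i : 'I_n) : 'cV[R]_n := delta_mx i 0.

End BinaryProgram.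

Arguments ones {R} N.
Arguments unitv {R n} i.

(* Main.v *)
Require Import Defs.
From mathcomp Require Import all_boot all_order all_algebra.
From mathcomp Require Import boolp classical_sets reals.
From mathcomp Require Import lra.

Import Order.TTheory GRing.Theory Num.Theory.
Local Open Scope classical_set_scope.
Local Open Scope ring_scope.

(** Both faces are treated at once: let [c] be the value of [z_i] on the face
and [d] the other one of 0 and 1. The claim is that the affine hull of the
polytope is that of the face enlarged by the single direction [0 (+) 0 (+) e_i],
so that the dimension drops by exactly one.

Two facts about feasible points suffice, and both come from a pair [x0], [y0]
of feasible points with [x0 + y0 <= e]. The points [x0 (+) y0 (+) z] belong to
the polytope for every binary [z], so all directions of the z-block occur, and
those keeping [z_i] equal to [c] occur inside the face. Moreover one of [x0],
[y0] vanishes at [i]; call it [u]. Then [x (+) u (+) z] and [u (+) x (+) z]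
belong to the polytope for every feasible [x] as soon as the binary
vector [z] is 1 away from [i], whatever [z_i] is. With [z_i = c] these points show that every direction
[x - u] occurs inside the face, in the x-block as well as in the y-block.
Hence, from the base point [u (+) u (+) z] with [z_i = c], every vertex of the
polytope is reached by directions of the face together with the direction
changing [z_i] from [c] to [d] ([facet_z]).

The dimensions of the polytope and of the face are never computed: they are
only compared ([facet_conv_hull]), which requires to know that every nonempty
set has an affine hull of the form point plus subspace
([affine_hull_translate]). *)

(** * Affine hulls as translates of subspaces *)

Lemma affine_hull_mono {R : realType} {N : nat} (S T : set 'cV[R]_N) :
  S `<=` T -> affine_hull S `<=` affine_hull T.
Proof.
move=> ST w [k [p [c [Sp c1 ->]]]].
by exists k, p, c; split=> // j; apply: ST.
Qed.

Lemma sub_conv_hull {R : realType} {N : nat} (S : set 'cV[R]_N) :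
  S `<=` conv_hull S.
Proof.
move=> w Sw; exists 1%N, (fun=> w), (fun=> 1); split=> //.
  by rewrite big_ord1.
by rewrite big_ord1 scale1r.
Qed.

Lemma conv_sub_affine_hull {R : realType} {N : nat} (S : set 'cV[R]_N) :
  conv_hull S `<=` affine_hull S.
Proof. by move=> w [k [p [c [Sp _ c1 ->]]]]; exists k, p, c. Qed.

Lemma sub_affine_hull {R : realType} {N : nat} (S : set 'cV[R]_N) :
  S `<=` affine_hull S.
Proof. by move=> w Sw; apply/conv_sub_affine_hull/sub_conv_hull. Qed.

Lemma affine_hull_sub_translate {R : realType} {N : nat} (S : set 'cV[R]_N)
    (p : 'cV[R]_N) (V : {vspace 'cV[R]_N}) :
  (forall w, S w -> w - p \in V) -> forall w, affine_hull S w -> w - p \in V.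
Proof.
move=> SV w [k [x [c [Sx c1 ->]]]].
have -> : \sum_j c j *: x j - p = \sum_j c j *: (x j - p).
  under [RHS]eq_bigr do rewrite scalerBr.
  by rewrite sumrB -scaler_suml c1 scale1r.
by apply: memv_suml => j _; apply/memvZ/SV.
Qed.

(** The coefficients of [w - p] on [s] become those of the points [p + v]; the
index 0 is reserved for [p] itself, whose coefficient brings the sum to 1. *)
Lemma affine_hull_translate_span {R : realType} {N : nat} (S : set 'cV[R]_N)
    (p : 'cV[R]_N) (s : seq 'cV[R]_N) :
  S p -> {in s, forall v, S (p + v)} ->
  forall w, w - p \in <<s>>%VS -> affine_hull S w.
Proof.
move=> Sp Ss w /(@coord_span _ _ _ (in_tuple s)) wE.
pose c j := coord (in_tuple s) j (w - p).
exists (size s).+1, (fun j => if unlift ord0 j is Some i then p + s`_i else p),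
  (fun j => if unlift ord0 j is Some i then c i else 1 - \sum_i c i).
split.
- by move=> j; case: unliftP => [l _|_] //; apply/Ss/mem_nth.
- rewrite big_ord_recl /= unlift_none.
  under [X in _ + X]eq_bigr do rewrite liftK.
  by rewrite subrK.
- rewrite big_ord_recl /= unlift_none.
  under [X in _ = _ + X]eq_bigr do rewrite liftK scalerDr.
  rewrite big_split /= -scaler_suml addrA -scalerDl subrK scale1r.
  by rewrite -[LHS](subrK p) wE addrC.
Qed.

(** The span of a possibly infinite set is reached by a finite part of it: a
finite part whose span has the greatest dimension cannot be enlarged. *)
Lemma finite_spanning_part {R : realType} {N : nat} (S : set 'cV[R]_N) :
  exists s : seq 'cV[R]_N,
    {in s, forall v, S v} /\ forall v, S v -> v \in <<s>>%VS.
Proof.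
pose attained d := `[< exists s : seq 'cV[R]_N,
  {in s, forall v, S v} /\ \dim <<s>> = d >].
have ex_att : exists d, attained d.
  by exists (\dim <<[::] : seq 'cV[R]_N>>); apply/asboolP; exists [::].
have att_le d : attained d -> (d <= \dim {:'cV[R]_N})%N.
  by move=> /asboolP [s [_ <-]]; apply/dimvS/subvf.
case: (ex_maxnP ex_att att_le) => d /asboolP [s [Ss ds]] d_max.
exists s; split=> // v Sv.
have Svs : {in v :: s, forall w, S w}.
  by move=> w; rewrite inE => /orP [/eqP ->|/Ss].
have /d_max dim_le : attained (\dim <<v :: s>>).
  by apply/asboolP; exists (v :: s).
have ss : (<<s>> <= <<v :: s>>)%VS by rewrite span_cons addvSr.
have /eqP -> : <<s>>%VS == <<v :: s>>%VS by rewrite eqEdim ss ds.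
by apply: memv_span; rewrite mem_head.
Qed.

Lemma affine_hull_translate {R : realType} {N : nat} (S : set 'cV[R]_N)
    (p : 'cV[R]_N) :
  S p -> exists U : {vspace 'cV[R]_N},
    affine_hull S = [set w | w - p \in U].
Proof.
move=> Sp; have [s [Ss sS]] := finite_spanning_part [set v | S (p + v)].
exists <<s>>%VS; apply/seteqP; split.
  by apply: affine_hull_sub_translate => w Sw; apply: sS; rewrite /= addrC subrK.
by move=> w; apply: affine_hull_translate_span.
Qed.

Lemma dim_add_line {K : fieldType} {vT : vectType K} (U : {vspace vT}) (v : vT) :
  v \notin U -> \dim (U + <[v]>) = (\dim U).+1.
Proof.
move=> vU; rewrite dimv_disjoint_sum.
  by rewrite dim_vline (contraNneq _ vU) ?addn1 // => ->; rewrite mem0v.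
apply/eqP; rewrite -subv0; apply/subvP => w; rewrite memv_cap memv0.
case/andP=> wU /vlineP [t wE]; move: wU; rewrite {w}wE.
by rewrite rpredZeq (negPf vU) orbF => /eqP ->; rewrite scale0r.
Qed.

(** * Facets of a convex hull *)

Lemma dotvD {R : realType} {N : nat} (a v w : 'cV[R]_N) :
  dotv a (v + w) = dotv a v + dotv a w.
Proof. by rewrite /dotv mulmxDr mxE. Qed.

Lemma dotv_sum {R : realType} {N k : nat} (a : 'cV[R]_N) (c : 'I_k -> R)
    (p : 'I_k -> 'cV[R]_N) :
  dotv a (\sum_j c j *: p j) = \sum_j c j * dotv a (p j).
Proof.
rewrite /dotv mulmx_sumr summxE; apply: eq_bigr => j _.
by rewrite -scalemxAr mxE.
Qed.

Lemma dotv_affine_hull {R : realType} {N : nat} (S : set 'cV[R]_N) a beta :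
  (forall w, S w -> dotv a w = beta) ->
  forall w, affine_hull S w -> dotv a w = beta.
Proof.
move=> Sa w [k [p [c [Sp c1 ->]]]]; rewrite dotv_sum.
under eq_bigr do rewrite Sa //.
by rewrite -mulr_suml c1 mul1r.
Qed.

Lemma valid_conv_hull {R : realType} {N : nat} (G : set 'cV[R]_N) a beta :
  valid_ineq G a beta -> valid_ineq (conv_hull G) a beta.
Proof.
move=> Ga w [k [p [c [Gp c0 c1 ->]]]]; rewrite dotv_sum.
rewrite -[beta]mul1r -c1 mulr_suml; apply: ler_sum => j _.
by apply: ler_wpM2l => //; apply: Ga.
Qed.

(** Adding the single generator [q] to the face must already produce the whole
affine hull; [q] is off the hyperplane, so it raises the dimension by exactly
one. Quantifying over all subspaces [D] that contain the directions of the face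
says that the remaining generators lie in the affine hull of the face and [q]
without exhibiting coefficients, and without computing any dimension. *)
Lemma facet_conv_hull {R : realType} {N : nat} (G : set 'cV[R]_N)
    (a : 'cV[R]_N) (beta : R) (p q : 'cV[R]_N) :
  valid_ineq G a beta -> G p -> dotv a p = beta -> G q -> dotv a q <> beta ->
  (forall D : {vspace 'cV[R]_N},
     (forall f, G f -> dotv a f = beta -> f - p \in D) ->
     forall g, G g -> g - p \in (D + <[q - p]>)%VS) ->
  facet_defining (conv_hull G) a beta.
Proof.
move=> Ga Gp ap Gq aq GD; split; first exact: valid_conv_hull.
set P := conv_hull G; set F := face P a beta.
have Pp : P p by apply: sub_conv_hull.
have Fp : F p by split.
have [D FE] := affine_hull_translate F p Fp.
have [U PE] := affine_hull_translate P p Pp.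
have memD w : affine_hull F w <-> w - p \in D by rewrite FE.
have memU w : affine_hull P w <-> w - p \in U by rewrite PE.
have qD : q - p \notin D.
  apply/negP => /memD Fq; apply: aq.
  by apply: dotv_affine_hull Fq => w [].
have UE : U = (D + <[q - p]>)%VS.
  apply/eqP; rewrite eqEsubv; apply/andP; split; last first.
    rewrite subv_add; apply/andP; split.
      apply/subvP => v vD; have /memD vF : p + v - p \in D by rewrite addrC addKr.
      have /memU : affine_hull P (p + v).
        by apply: affine_hull_mono vF => w [].
      by rewrite addrC addKr.
    by rewrite -memvE; apply/memU/sub_affine_hull/sub_conv_hull.
  apply/subvP => v vU.
  have /memU vP : p + v - p \in U by rewrite addrC addKr.
  have : p + v - p \in (D + <[q - p]>)%VS.
    apply: (affine_hull_sub_translate P) vP => w /conv_sub_affine_hull.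
    apply: affine_hull_sub_translate; apply: GD => f Gf af.
    by apply/memD/sub_affine_hull; split=> //; apply: sub_conv_hull.
  by rewrite addrC addKr.
exists (\dim D); split; last by exists p, D.
by exists p, U; split=> //; rewrite UE dim_add_line.
Qed.

(** * The generators of the diameter polytope *)

Definition diameter_vertices {R : realType} {m n : nat} (A : 'M[R]_(m, n))
    (b : 'cV[R]_m) : set 'cV[R]_(n + n + n) :=
  [set w | exists x y z : 'cV[R]_n,
    [/\ w = concat3 x y z, binary w, le_vec (A *m x) b, le_vec (A *m y) b
      & le_vec (x + y - z) (ones n)]].

Lemma binary_concat3 {R : realType} {n : nat} (x y z : 'cV[R]_n) :
  binary (concat3 x y z) <-> [/\ binary x, binary y & binary z].
Proof.
split=> [bw | [bx by_ bz] j].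
  split=> j; [have := bw (lshift n (lshift n j))
    | have := bw (lshift n (rshift n j)) | have := bw (rshift (n + n) j)];
    by rewrite /concat3 ?col_mxEu ?col_mxEd.
rewrite /concat3 -(splitK j); case: (split j) => k; last by rewrite col_mxEd.
rewrite col_mxEu -(splitK k).
by case: (split k) => l; rewrite ?col_mxEu ?col_mxEd.
Qed.

Lemma diameter_verticesP {R : realType} {m n : nat} (A : 'M[R]_(m, n))
    (b : 'cV[R]_m) (w : 'cV[R]_(n + n + n)) :
  diameter_vertices A b w <-> exists x y z : 'cV[R]_n,
    [/\ w = concat3 x y z, Fes A b x, Fes A b y, binary z
      & le_vec (x + y - z) (ones n)].
Proof.
split=> [[x [y [z [-> /binary_concat3 [bx by_ bz] Ax Ay le_e]]]]
        | [x [y [z [-> [bx Ax] [by_ Ay] bz le_e]]]]].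
  by exists x, y, z; split.
by exists x, y, z; split=> //; apply/binary_concat3.
Qed.

Lemma concat3B {R : realType} {n : nat} (x y z x' y' z' : 'cV[R]_n) :
  concat3 x y z - concat3 x' y' z' = concat3 (x - x') (y - y') (z - z').
Proof. by rewrite /concat3 !opp_col_mx !add_col_mx. Qed.

Lemma concat3D {R : realType} {n : nat} (x y z x' y' z' : 'cV[R]_n) :
  concat3 x y z + concat3 x' y' z' = concat3 (x + x') (y + y') (z + z').
Proof. by rewrite /concat3 !add_col_mx. Qed.

Lemma scale_concat3 {R : realType} {n : nat} (t : R) (x y z : 'cV[R]_n) :
  t *: concat3 x y z = concat3 (t *: x) (t *: y) (t *: z).
Proof. by rewrite /concat3 !scale_col_mx. Qed.

Lemma dotv_unit_z {R : realType} {n : nat} (s : R) (i : 'I_n) (x y z : 'cV[R]_n) :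
  dotv (concat3 0 0 (s *: unitv i)) (concat3 x y z) = s * z i 0.
Proof.
rewrite /dotv /concat3 !tr_col_mx !mul_row_col !trmx0 !mul0mx !add0r.
rewrite linearZ /= /unitv trmx_delta -scalemxAl -rowE.
by rewrite !mxE.
Qed.

(** * The faces cut out by a coordinate of z *)

Definition update {R : realType} {n : nat} (z : 'cV[R]_n) (i : 'I_n) (c : R) :
    'cV[R]_n :=
  \col_j (if j == i then c else z j 0).

Lemma update_eq {R : realType} {n : nat} (z : 'cV[R]_n) (i : 'I_n) (c : R) :
  update z i c i 0 = c.
Proof. by rewrite mxE eqxx. Qed.

Lemma binary_update {R : realType} {n : nat} (z : 'cV[R]_n) (i : 'I_n) (c : R) :
  c = 0 \/ c = 1 -> binary z -> binary (update z i c).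
Proof. by move=> c01 bz j; rewrite mxE; case: eqP. Qed.

Lemma binary_ones {R : realType} {n : nat} : binary (ones n : 'cV[R]_n).
Proof. by move=> j; right; rewrite mxE. Qed.

(** The first difference on the right keeps coordinate [i] at [c], hence is a
direction of the face; only the second one moves [z_i]. *)
Lemma update_decomp {R : realType} {n : nat} (z e : 'cV[R]_n) (i : 'I_n) (c d t : R) :
  z i 0 - c = t * (d - c) ->
  z - update e i c
    = update z i c - update e i c + t *: (update e i d - update e i c).
Proof.
move=> h; apply/matrixP => j k; rewrite (ord1 k) !mxE.
by case: eqP => [->|_]; [rewrite subrr add0r | rewrite subrr mulr0 addr0].
Qed.

(** The factor [s] makes one statement serve both inequalities: [s * z_i] is
maximal at [z_i = c], with [(s, c)] equal to [(-1, 0)] for [z_i >= 0] and to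
[(1, 1)] for [z_i <= 1]. *)
Lemma facet_z {R : realType} {m n : nat} (A : 'M[R]_(m, n)) (b : 'cV[R]_m)
    (i : 'I_n) (s c d : R) (u x0 y0 : 'cV[R]_n) :
  c = 0 \/ c = 1 -> d = 0 \/ d = 1 -> s * d < s * c ->
  Fes A b u -> u i 0 = 0 ->
  Fes A b x0 -> Fes A b y0 -> le_vec (x0 + y0) (ones n) ->
  facet_defining (diameter_polytope A b) (concat3 0 0 (s *: unitv i)) (s * c).
Proof.
move=> c01 d01 sdc Fu ui0 Fx0 Fy0 xy0.
have dc : d - c != 0 by rewrite subr_eq0; apply: contraTneq sdc => ->; rewrite ltxx.
have z_cd (z : R) : z = 0 \/ z = 1 -> z = c \/ z = d.
  have := dc; case: c01 => ->; case: d01 => -> h [] ->; try by [left | right];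
  by move: h; rewrite subrr eqxx.
pose one_but t : 'cV[R]_n := update (ones n) i t.
have vert_xu x t : Fes A b x -> t = 0 \/ t = 1 ->
    diameter_vertices A b (concat3 x u (one_but t)) /\
    diameter_vertices A b (concat3 u x (one_but t)).
  move=> Fx t01.
  (* At i the constraint is x_i <= 1 + t since u_i = 0; elsewhere it is
     x_j + u_j <= 2. *)
  have le_e : le_vec (x + u - one_but t) (ones n).
    move=> j; rewrite !mxE; have [bx _] := Fx; have [bu _] := Fu.
    case: eqP => [->|_].
      by rewrite ui0; case: (bx i) => ->; case: t01 => ->; lra.
    by case: (bx j) => ->; case: (bu j) => ->; lra.
  have bz : binary (one_but t) by apply: binary_update => //; apply: binary_ones.
  split; apply/diameter_verticesP; first by exists x, u, (one_but t).
  by exists u, x, (one_but t); split=> //; rewrite (addrC u).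
have vert_0 z : binary z -> diameter_vertices A b (concat3 x0 y0 z).
  move=> bz; apply/diameter_verticesP; exists x0, y0, z; split=> // j.
  by have := xy0 j; rewrite !mxE; case: (bz j) => ->; lra.
apply: (@facet_conv_hull _ _ (diameter_vertices A b) _ _
  (concat3 u u (one_but c)) (concat3 u u (one_but d))).
- move=> w /diameter_verticesP [x [y [z [-> _ _ bz _]]]].
  by rewrite dotv_unit_z; case: (z_cd _ (bz i)) => -> //; apply: ltW.
- exact: (vert_xu u c Fu c01).1.
- by rewrite dotv_unit_z update_eq.
- exact: (vert_xu u d Fu d01).1.
- by rewrite dotv_unit_z update_eq => h; rewrite h ltxx in sdc.
move=> D FD g /diameter_verticesP [x [y [z [-> Fx Fy bz _]]]].
set p := concat3 u u (one_but c); set q := concat3 u u (one_but d).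
have xD : concat3 x u (one_but c) - p \in D.
  by apply: FD; [exact: (vert_xu x c Fx c01).1 | rewrite dotv_unit_z update_eq].
have yD : concat3 u y (one_but c) - p \in D.
  by apply: FD; [exact: (vert_xu y c Fy c01).2 | rewrite dotv_unit_z update_eq].
have zD : concat3 x0 y0 (update z i c) - concat3 x0 y0 (one_but c) \in D.
  rewrite -[concat3 x0 y0 (update z i c)](subrK p) -addrA -[p - _]opprB.
  apply: rpredB; apply: FD; rewrite ?dotv_unit_z ?update_eq //; apply: vert_0;
    apply: binary_update => //; exact: binary_ones.
(* The terms change, in turn, the x-block, the y-block, the z-block away from
   coordinate i, and z_i. *)
pose t := (z i 0 - c) / (d - c).
have -> : concat3 x y z - p
    = (concat3 x u (one_but c) - p) + (concat3 u y (one_but c) - p)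
      + (concat3 x0 y0 (update z i c) - concat3 x0 y0 (one_but c))
      + t *: (q - p).
  rewrite !concat3B scale_concat3 !concat3D !subrr !scaler0 !addr0 !add0r.
  by congr concat3; apply: update_decomp; rewrite divfK.
apply: memv_add; first by apply: rpredD => //; apply: rpredD.
by apply: memvZ; apply: memv_line.
Qed.

(* z_i >= 0 is written (0 (+) 0 (+) -e_i)^T w <= 0, and z_i <= 1 is written
   (0 (+) 0 (+) e_i)^T w <= 1. *)
Theorem theorem2p12 (R : realType) (m n : nat)
    (A : 'M[R]_(m, n)) (b : 'cV[R]_m)
    (Fes_neq0 : Fes A b !=set0)
    (Hdisj : forall xbar, Fes A b xbar ->
       exists ybar, Fes A b ybar /\ le_vec (xbar + ybar) (ones n))
    (i : 'I_n) :
  facet_defining (diameter_polytope A b) (concat3 0 0 (- unitv i)) 0 /\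
  facet_defining (diameter_polytope A b) (concat3 0 0 (unitv i)) 1.
Proof.
have [x0 Fx0] := Fes_neq0; have [y0 [Fy0 xy0]] := Hdisj x0 Fx0.
have [u Fu ui0] : exists2 u, Fes A b u & u i 0 = 0.
  have [bx _] := Fx0; have [by_ _] := Fy0.
  case: (bx i) => xi; first by exists x0.
  exists y0 => //; case: (by_ i) => // yi.
  by have := xy0 i; rewrite !mxE xi yi; lra.
split.
  have := facet_z A b i (-1) 0 1 u x0 y0.
  by rewrite scaleN1r mulr0; apply=> //; [left | right | lra].
have := facet_z A b i 1 1 0 u x0 y0.
by rewrite scale1r mulr1; apply=> //; [right | left | lra].
Qed.
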